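(* Let $(S,+,\cdot,-,\ast)$ be a weak left $\star$-brace. Then $(S,+,-)$ is completely regular, orthodox and locally inverse, and $(S,\cdot,\ast)$ is orthodox and locally inverse.
   Context: A regular $\star$-semigroup is a triple $(S,\cdot,\ast)$ where $(S,\cdot)$ is a semigroup on a non-empty set and $\ast:S\to S$, $x\mapsto x^\ast$, satisfies $xx^\ast x=x$, $(x^\ast)^\ast=x$, $(xy)^\ast=y^\ast x^\ast$ for all $x,y\in S$. It is called completely regular if $a\,\mathcal H\,a^2$ for all $a\in S$ ($\mathcal H=\mathcal L\cap\mathcal R$ being Green's relation of the underlying semigroup), orthodox if the product of any two idempotents is idempotent, and locally inverse if $eSe$ is an inverse semigroup for every idempotent $e$. A weak left $\star$-brace is $(S,+,\cdot,-,\ast)$ where $(S,+,-)$ and $(S,\cdot,\ast)$ are regular $\star$-semigroups on the same set $S$ (the unary operation of $(S,+)$ is $x\mapsto -x$, that of $(S,\cdot)$ is $x\mapsto x^\ast$; the addition need not be commutative) such that for all $x,y,z\in S$: $x(y+z)=xy-x+xz$ and $-x+x=xx^\ast$. Here multiplication has precedence over addition and $x-y$ means $x+(-y)$. *)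

(* Defs.v *)
From mathcomp Require Import ssreflect ssrfun ssrbool.

Set Implicit Arguments.
Unset Strict Implicit.
Unset Printing Implicit Defensive.

(* The operation is an explicit parameter, rather than a canonical structure on
   S, because a brace carries two semigroup operations on the same set. *)

Record regular_star_semigroup (S : Type) (op : S -> S -> S) (star : S -> S)
    : Prop := RegularStarSemigroup {
  rss_nonempty : inhabited S;
  rss_assoc : associative op;
  rss_regular : forall x, op (op x (star x)) x = x;
  rss_involutive : involutive star;
  rss_antimorph : forall x y, star (op x y) = op (star y) (star x)
}.

(* S^1 a and a S^1; the disjunct x = a accounts for the adjoined identity. *)
Definition left_ideal (S : Type) (op : S -> S -> S) (a x : S) : Prop :=
  x = a \/ exists s, x = op s a.

Definition right_ideal (S : Type) (op : S -> S -> S) (a x : S) : Prop :=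
  x = a \/ exists s, x = op a s.

Definition green_L (S : Type) (op : S -> S -> S) (a b : S) : Prop :=
  forall x, left_ideal op a x <-> left_ideal op b x.

Definition green_R (S : Type) (op : S -> S -> S) (a b : S) : Prop :=
  forall x, right_ideal op a x <-> right_ideal op b x.

Definition green_H (S : Type) (op : S -> S -> S) (a b : S) : Prop :=
  green_L op a b /\ green_R op a b.

Definition completely_regular (S : Type) (op : S -> S -> S) : Prop :=
  forall a, green_H op a (op a a).

Definition idempotent_elt (S : Type) (op : S -> S -> S) (e : S) : Prop :=
  op e e = e.

Definition orthodox (S : Type) (op : S -> S -> S) : Prop :=
  forall e f, idempotent_elt op e -> idempotent_elt op f ->
    idempotent_elt op (op e f).

(* The subset P is an inverse semigroup under op; associativity is inherited
   from S, so it is not repeated. *)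
Definition inverse_subsemigroup (S : Type) (op : S -> S -> S) (P : S -> Prop)
    : Prop :=
  (forall x y, P x -> P y -> P (op x y)) /\
  (forall x, P x ->
    exists! y, [/\ P y, op (op x y) x = x & op (op y x) y = y]).

Definition local_subsemigroup (S : Type) (op : S -> S -> S) (e x : S) : Prop :=
  exists s, x = op (op e s) e.

Definition locally_inverse (S : Type) (op : S -> S -> S) : Prop :=
  forall e, idempotent_elt op e ->
    inverse_subsemigroup op (local_subsemigroup op e).

Record weak_left_star_brace (S : Type) (add mul : S -> S -> S)
    (opp star : S -> S) : Prop := WeakLeftStarBrace {
  wlsb_add : regular_star_semigroup add opp;
  wlsb_mul : regular_star_semigroup mul star;
  wlsb_distr : forall x y z,
    mul x (add y z) = add (add (mul x y) (opp x)) (mul x z);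
  wlsb_compat : forall x, add (opp x) x = mul x (star x)
}.

(* Main.v *)
Require Import Defs.
From mathcomp Require Import ssreflect ssrfun ssrbool.

(** Both operations have the same projections (self-adjoint idempotents) with
    the same natural order. Hence [p y = y + p] for every projection [p] and
    every [y]; distributivity of [p] over [y + z] then reads
    [y + z + p = y + p + z + p]. This identity makes the additive idempotents
    a normal band, i.e. [(S, +)] orthodox and locally inverse, and since
    [e y = y + e] for every idempotent [e] these properties pass to the
    multiplication. Complete regularity comes from expanding
    [x = x (- x* + x* )]. *)

Set Implicit Arguments.
Unset Strict Implicit.
Unset Printing Implicit Defensive.

(** * Regular star-semigroups *)

Section RegularStar.

Variables (S : Type) (op : S -> S -> S) (star : S -> S).
Hypothesis hop : regular_star_semigroup op star.

Local Notation "x * y" := (op x y).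
Local Notation "x ^*" := (star x).

Definition projection (p : S) : Prop := p * p = p /\ p^* = p.

Let opA : associative op := rss_assoc hop.
Let opK (x : S) : x * x^* * x = x := rss_regular hop x.
Let starK : involutive star := rss_involutive hop.
Let starM (x y : S) : (x * y)^* = y^* * x^* := rss_antimorph hop x y.

Lemma projection_mul_star (x : S) : projection (x * x^*).
Proof. by split; [rewrite opA opK | rewrite starM starK]. Qed.

Lemma projection_star_mul (x : S) : projection (x^* * x).
Proof. by have := projection_mul_star x^*; rewrite starK. Qed.

Lemma idempotent_star (e : S) :
  idempotent_elt op e -> idempotent_elt op e^*.
Proof. by rewrite /idempotent_elt -starM => ->. Qed.

(** Since [e^*] is idempotent too, [e e^* e^* e] collapses to [e e^* e = e]. *)
Lemma idempotent_factor (e : S) : idempotent_elt op e ->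
  exists p q, [/\ projection p, projection q & e = p * q].
Proof.
move=> /idempotent_star he; exists (e * e^*), (e^* * e); split.
- exact: projection_mul_star.
- exact: projection_star_mul.
- by rewrite opA -(opA e) [e^* * e^*]he opK.
Qed.

Lemma green_H_sqr (x : S) :
  (exists s, x = s * (x * x)) -> (exists s, x = x * x * s) ->
  green_H op x (x * x).
Proof.
move=> [s hs] [t ht]; split=> y; split.
- case=> [->|[u ->]]; right; first by exists s.
  by exists (u * s); rewrite -opA -hs.
- case=> [->|[u ->]]; right; first by exists x.
  by exists (u * x); rewrite opA.
- case=> [->|[u ->]]; right; first by exists t.
  by exists (t * u); rewrite opA -ht.
- case=> [->|[u ->]]; right; first by exists x.
  by exists (x * u); rewrite opA.
Qed.

Lemma local_subsemigroup_fixed (e x : S) :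
  idempotent_elt op e -> local_subsemigroup op e x -> e * x = x /\ x * e = x.
Proof. by move=> he [s ->]; split; [rewrite !opA he | rewrite -!opA he]. Qed.

(** A regular semigroup with commuting idempotents is inverse; this is carried out inside each
    [eSe], whose elements are those fixed by [e] on both sides. *)
Lemma locally_inverse_commuting :
  (forall e f g,
     idempotent_elt op e -> idempotent_elt op f -> idempotent_elt op g ->
     e * f = f -> f * e = f -> e * g = g -> g * e = g -> f * g = g * f) ->
  locally_inverse op.
Proof.
move=> comm e he; split=> [x y hx hy|x hx].
  have [ex _] := local_subsemigroup_fixed he hx.
  have [_ ye] := local_subsemigroup_fixed he hy.
  by exists (x * y); rewrite opA ex -opA ye.
have [ex xe] := local_subsemigroup_fixed he hx.
have [y [hy xyx yxy]] :
    exists y, [/\ local_subsemigroup op e y, x * y * x = x & y * x * y = y].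
  (* Compressing [x^*] to [eSe] still gives an inverse of [x], because [e] fixes [x] on both
     sides. *)
  exists (e * x^* * e); split; first by exists x^*.
    by rewrite !opA xe -(opA _ e) ex opK.
  rewrite -!opA (opA e x) ex (opA x e) xe (opA x^* x) (opA (x^* * x)).
  by rewrite -{2}(starK x) opK.
exists y; split=> // z [hz xzx zxz].
have [ey ye] := local_subsemigroup_fixed he hy.
have [ez ze] := local_subsemigroup_fixed he hz.
have idem u v : u * v * u = u -> idempotent_elt op (u * v).
  by rewrite /idempotent_elt opA => ->.
have xyz : (x * y) * (x * z) = (x * z) * (x * y).
  by apply: (comm e) => //;
    first [exact: idem | rewrite opA ex | rewrite -opA ?ye ?ze].
have yxz : (y * x) * (z * x) = (z * x) * (y * x).
  by apply: (comm e) => //;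
    first [exact: idem | rewrite opA | rewrite -opA xe];
    rewrite ?ey ?ez.
(* For two inverses [y] and [z], [xyxz = xz] and [xzxy = xy], so commuting forces equality; dually
   for [yx] and [zx]. *)
have xyxz : x * y = x * z.
  by move: xyz; rewrite !opA xyx xzx => ->.
have yxzx : y * x = z * x.
  by move: yxz; rewrite -(opA y) (opA x z x) xzx -(opA z) (opA x y x) xyx.
by rewrite -yxy yxzx -opA xyxz opA zxz.
Qed.

(** * The sandwich identity and its consequences for idempotents *)

Section Sandwich.

Hypothesis projection_sandwich :
  forall y z p, projection p -> y * z * p = y * p * z * p.

(** With [e = pq] a product of projections, first insert [p], then insert [q] between [yp] and
    [zp]. *)
Lemma sandwich_right (y z e : S) :
  idempotent_elt op e -> y * z * e = y * e * z * e.
Proof.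
move=> /idempotent_factor[p [q [hp hq ->]]].
rewrite !opA (projection_sandwich y z hp) -(opA _ z p).
by rewrite (projection_sandwich (y * p) (z * p) hq) !opA.
Qed.

Lemma sandwich_left (y z e : S) :
  idempotent_elt op e -> e * z * y = e * z * e * y.
Proof.
move=> /idempotent_star he; apply: (can_inj starK).
by rewrite !starM !opA; apply: sandwich_right.
Qed.

Lemma sandwich_orthodox : orthodox op.
Proof.
move=> e f he hf; rewrite /idempotent_elt opA -(sandwich_left f f he).
by rewrite -opA hf.
Qed.

(** Both products equal [gfg]: [fg = efg = egfg = gfg] and [gf = gfe = gfge = gfg]. *)
Lemma sandwich_commuting (e f g : S) :
  idempotent_elt op f -> idempotent_elt op g ->
  e * f = f -> f * e = f -> e * g = g -> g * e = g -> f * g = g * f.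
Proof.
move=> hf hg ef fe eg ge.
have -> : f * g = g * f * g.
  by have := sandwich_right e f hg; rewrite ef eg.
by have := sandwich_left e f hg; rewrite -!opA fe ge.
Qed.

End Sandwich.

End RegularStar.

(** * Weak left star-braces *)

Section Brace.

Variables (S : Type) (add mul : S -> S -> S) (opp star : S -> S).
Hypothesis hS : weak_left_star_brace add mul opp star.

Local Notation "x + y" := (add x y).
Local Notation "x * y" := (mul x y).
Local Notation "- x" := (opp x).
Local Notation "x ^*" := (star x).

Let hadd : regular_star_semigroup add opp := wlsb_add hS.
Let hmul : regular_star_semigroup mul star := wlsb_mul hS.
Let addA : associative add := rss_assoc hadd.
Let mulA : associative mul := rss_assoc hmul.
Let addK (x : S) : x + - x + x = x := rss_regular hadd x.
Let mulK (x : S) : x * x^* * x = x := rss_regular hmul x.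
Let oppK : involutive opp := rss_involutive hadd.
Let starK : involutive star := rss_involutive hmul.
Let oppD (x y : S) : - (x + y) = - y + - x := rss_antimorph hadd x y.
Let starM (x y : S) : (x * y)^* = y^* * x^* := rss_antimorph hmul x y.
Let mulDr (x y z : S) : x * (y + z) = x * y + - x + x * z :=
  wlsb_distr hS x y z.
Let compat (x : S) : - x + x = x * x^* := wlsb_compat hS x.

(** In both directions [p = - p + p = p p^*], and this element is a projection for either
    operation. *)
Lemma projection_addE (p : S) :
  projection add opp p <-> projection mul star p.
Proof.
split=> -[pp pN].
- have e : p * p^* = p by rewrite -compat pN.
  by rewrite -e; apply: projection_mul_star.
- have e : - p + p = p by rewrite compat pN.
  by rewrite -e; apply: projection_star_mul.
Qed.

Lemma projection_mulDr (p y z : S) :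
  projection mul star p -> p * (y + z) = p * y + p + p * z.
Proof. by move=> /projection_addE[_ pN]; rewrite mulDr pN. Qed.

Lemma projection_order (p r : S) :
  projection mul star p -> projection mul star r ->
  p * r = r -> r + p = r /\ p + r = r.
Proof.
move=> hp hr pr.
have [/projection_addE[rr rN] /projection_addE[pp pN]] := (hr, hp).
have rp : r * p = r by rewrite -{1}hr.2 -{1}hp.2 -starM pr hr.2.
have rpr : r + p + r = r.
  by rewrite -{1 2}pr -projection_mulDr // rr pr.
have pDr : p + r = r.
  (* Here [(p + r)(p + r)^* = - (p + r) + (p + r) = r + p + r = r], so [p + r = r (p + r)], which
     distributes to [r + r + r]. *)
  rewrite -[LHS]mulK -compat oppD rN pN addA -(addA r) pp rpr.
  by rewrite projection_mulDr // rp rr hr.1 rr.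
by split=> //; rewrite -[LHS]oppK oppD rN pN pDr.
Qed.

(** The projection [r = z z^* = - z + z] supports [z] on the left for multiplication and on the
    right for addition, which reduces the claim to comparing [r] with [p]. *)
Lemma mul_fixed_add_fixed (p z : S) :
  projection mul star p -> p * z = z <-> z + p = z.
Proof.
move=> hp.
have [r [hr rE rE']] :
    exists r, [/\ projection mul star r, z * z^* = r & - z + z = r].
  by exists (z * z^*); split=> //; apply: projection_mul_star.
have [/projection_addE[rr rN] /projection_addE[pp pN]] := (hr, hp).
split=> fix_z.
  have [|rp _] := projection_order hp hr; first by rewrite -rE mulA fix_z.
  by rewrite -{1}(addK z) -(addA z) -addA rE' rp -rE' addA.
have rDp : r + p = r by rewrite -rE' -addA fix_z.
have pDr : p + r = r by rewrite -[LHS]oppK oppD rN pN rDp.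
(* [r = r (p + r) = r p + r], and [r p + r = r p] because [r (r p) = r p]. *)
have rp : r * p = r.
  have hq : projection mul star (r * p * (r * p)^*).
    exact: projection_mul_star.
  have [|qr _] := projection_order hr hq; first by rewrite !mulA hr.1.
  have rpr : r * p + r = r * p.
    by rewrite -{1}(addK (r * p)) -(addA (r * p)) -addA compat qr -compat addA.
  have := projection_mulDr p r hr.
  by rewrite pDr hr.1 -addA rr rpr => /esym.
have pr : p * r = r by rewrite -{1}hr.2 -{1}hp.2 -starM rp hr.2.
by rewrite -{1}(mulK z) rE mulA pr -rE mulK.
Qed.

(** Both sides equal [p (y + p)]: adding [p] again fixes [y + p], so multiplying by [p] fixes it
    too; distributing instead gives [p y + p], which is [p y] since [p (p y) = p y]. *)
Lemma projection_mulE (p y : S) : projection mul star p -> p * y = y + p.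
Proof.
move=> hp; have [pp _] : projection add opp p by apply/projection_addE.
have <- : p * (y + p) = y + p.
  by apply/mul_fixed_add_fixed => //; rewrite -addA pp.
rewrite projection_mulDr // hp.1 -addA pp; apply/esym.
by apply/(mul_fixed_add_fixed _ hp); rewrite mulA hp.1.
Qed.

Lemma add_projection_sandwich (y z p : S) :
  projection add opp p -> y + z + p = y + p + z + p.
Proof.
move=> hp; have hp' : projection mul star p by apply/projection_addE.
have := projection_mulDr y z hp'.
by rewrite !projection_mulE // !addA -(addA y p p) hp.1.
Qed.

(** A product [pq] of projections is the sum [q + p], and sums of additive idempotents are already
    known to be idempotent. *)
Lemma brace_idempotentE (e : S) :
  idempotent_elt mul e <-> idempotent_elt add e.
Proof.
have orth := sandwich_orthodox hadd add_projection_sandwich.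
split=> he.
- have [p [q [hp hq ->]]] := idempotent_factor hmul he.
  rewrite projection_mulE //; apply: orth.
  + by have [] : projection add opp q by apply/projection_addE.
  + by have [] : projection add opp p by apply/projection_addE.
- have [p [q [hp hq ->]]] := idempotent_factor hadd he.
  have /projection_addE hp' := hp; have /projection_addE hq' := hq.
  rewrite -(projection_mulE _ hq') /idempotent_elt.
  rewrite -mulA !projection_mulE // -(addA (p + q)).
  exact: (orth p q hp.1 hq.1).
Qed.

Lemma idempotent_mulE (e y : S) : idempotent_elt mul e -> e * y = y + e.
Proof.
move=> /(idempotent_factor hmul)[p [q [hp hq ->]]].
by rewrite -mulA !projection_mulE // addA.
Qed.

(** Once [p] lies in [S + (q + p)], the idempotent [q + p] fixes it on the right. *)
Lemma brace_friendly_projections (x : S) :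
  (- x + x) + (x + - x) + (- x + x) = - x + x.
Proof.
set p := - x + x; set q := x + - x.
have qp_idem : (q + p) + (q + p) = q + p.
  apply: (sandwich_orthodox hadd add_projection_sandwich).
  - exact: (projection_mul_star hadd x).1.
  - exact: (projection_star_mul hadd x).1.
have [a pE] : exists a, p = a + (q + p).
  (* Distributing [x = x (- x^* + x^* )] gives [x = x * - x^* + - x + p]. Substitute this for [x] in
     [p = - x + x] and expand the second [- x] as [- x + q]. *)
  exists (- x + (x * - x^* + - x)).
  have xE : x * - x^* + - x + p = x.
    by rewrite /p compat -mulDr compat starK mulA mulK.
  have negE : - x + x + - x = - x by rewrite -{2 4}(oppK x) addK.
  rewrite {1}/p -{2}xE /q !addA -(addA _ x) -(addA _ (- x) (x + _)).
  by rewrite (addA (- x) x) negE.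
by rewrite -addA {1}pE -(addA a) qp_idem -pE.
Qed.

Lemma brace_add_completely_regular : completely_regular add.
Proof.
move=> x; apply: (green_H_sqr hadd).
- exists (x + - x + - x).
  (* The last three terms [x + - x + x] collapse to [x], leaving [x + x] on the right. The identity
     used is the previous lemma at [- x], which exchanges the two projections. *)
  have xE : x = (x + - x) + (- x + x) + (x + - x) + x.
    by have := brace_friendly_projections (- x); rewrite oppK => ->; rewrite addK.
  by rewrite {1}xE -!addA (addA x (- x) x) addK.
- exists (- x + - x + x).
  have xE : x = x + ((- x + x) + (x + - x) + (- x + x)).
    by rewrite brace_friendly_projections addA addK.
  by rewrite {1}xE !addA addK.
Qed.

End Brace.

Theorem theorem5p15 (S : Type) (add mul : S -> S -> S) (opp star : S -> S)
    (hS : weak_left_star_brace add mul opp star) :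
  [/\ completely_regular add, orthodox add & locally_inverse add] /\
  (orthodox mul /\ locally_inverse mul).
Proof.
have sand := add_projection_sandwich hS.
have orth := sandwich_orthodox (wlsb_add hS) sand.
have comm := sandwich_commuting (wlsb_add hS) sand.
split; first split=> //.
- exact: brace_add_completely_regular hS.
- by apply: (locally_inverse_commuting (wlsb_add hS)) => e f g _; apply: comm.
split=> [e f he hf|].
  apply/(brace_idempotentE hS); rewrite (idempotent_mulE hS) //.
  by apply: orth; apply/(brace_idempotentE hS).
apply: (locally_inverse_commuting (wlsb_mul hS)) => e f g he hf hg ef fe eg ge.
have idem := brace_idempotentE hS.
(* Idempotents multiply as they add in reverse order, so the additive commutation applies with left
   and right exchanged. *)
move: ef fe eg ge; rewrite !(idempotent_mulE hS) // => fe ef ge eg.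
by apply/esym/(comm e) => //; apply/idem.
Qed.
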